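(* For each integer $k\ge1$ there exists $C_k>0$ such that for all $x\in(0,1)$ and all $r\in\mathbb{N}$ for which $x_0,\dots,x_{r-1}\ne0$ (in particular for all $r$ if $x$ is irrational), $$\left|B_{k,\mathrm{finite}}\left(\frac{p_r(x)}{q_r(x)}\right)-\sum_{j=0}^{r-1}\left(\beta_{j-1}(x)\right)^k\log\frac1{x_j}\right|\le C_k\,x_r\,(q_r(x))^{-1}$$ and $$\left|W_{\mathrm{finite}}\left(\frac{p_r(x)}{q_r(x)}\right)-\sum_{j=0}^{r-1}(-1)^j\beta_{j-1}(x)\log\frac1{x_j}\right|\le C_1\,x_r\,(q_r(x))^{-1}.$$
   Context: Gauss map: $G(0)=0$, $G(x)=\{1/x\}$ for $x\in(0,1)$. For $x\in(0,1)$: $x_j=G^j(x)$, $\beta_{-1}(x)=1$, $\beta_j(x)=\prod_{i=0}^jx_i$; $p_r(x)/q_r(x)=[0;m_1,\dots,m_r]$ is the $r$-th principal convergent (in lowest terms) of the regular continued fraction of $x$, with $m_{j+1}=\lfloor1/x_j\rfloor$. For a rational number $p/q=[m_0;m_1,\dots,m_s]$ written as a regular continued fraction of length $s$ with $m_s\ge2$ when $q>1$ (and $s=0$ if $q=1$), $$B_{k,\mathrm{finite}}(p/q)=\sum_{j=0}^{s-1}\left(\beta_{j-1}(p/q-m_0)\right)^k\log\left(\frac1{G^j(p/q-m_0)}\right),$$ $$W_{\mathrm{finite}}(p/q)=\sum_{j=0}^{s-1}(-1)^j\beta_{j-1}(p/q-m_0)\log\left(\frac1{G^j(p/q-m_0)}\right).$$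 *)

(* Defs.v *)
From HB Require Import structures.
From mathcomp Require Import all_boot all_order all_algebra.
From mathcomp Require Import classical_sets reals exp.

Set Implicit Arguments.
Unset Strict Implicit.
Unset Printing Implicit Defensive.

Import Order.TTheory GRing.Theory Num.Theory.

Local Open Scope ring_scope.

(* Finite continued fractions: [cfrac m0 [:: m1; ...; ms]] is [m0; m1, ..., ms]. *)
Fixpoint cfrac (m0 : int) (m : seq int) : rat :=
  if m is m1 :: m' then m0%:~R + (cfrac m1 m')^-1 else m0%:~R.

Definition is_rcf (y : rat) (e : int * seq int) : bool :=
  [&& y == cfrac e.1 e.2,
      all (fun a => 1 <= a) e.2 &
      if denq y == 1 then e.2 == [::] else 2 <= last 0 e.2].

Lemma denq_frac_le (i a : int) : 0 < a -> denq (i%:~R / a%:~R) <= a.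
Proof.
move=> a0; rewrite -(fracqE (i, a)) den_fracq /= gt_eqF //=.
by rewrite -[leRHS]gtz0_abs // lez_nat leq_div.
Qed.

Lemma rcf_floor_exists (y : rat) : exists m, is_rcf y (Num.floor y, m).
Proof.
have [n] := ubnP `|denq y|%N; elim: n y => // n IHn y; rewrite ltnS => len.
case: (boolP (denq y == 1)) => [d1|dN1].
  exists [::]; rewrite /is_rcf /= d1 eqxx andbT.
  by rewrite eq_sym -intrEfloor Qint_def.
pose f := y - (Num.floor y)%:~R.
have f_ge0 : 0 <= f by rewrite subr_ge0 floor_le.
have f_lt1 : f < 1 by rewrite ltrBlDr addrC -[X in _ + X]/(1%:~R) -intrD floorD1_gt.
have f_neq0 : f != 0.
  apply: contra dN1; rewrite subr_eq0 eq_sym => /eqP fE.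
  by rewrite -Qint_def -fE; apply: intr_int.
have f_gt0 : 0 < f by rewrite lt0r f_neq0.
pose a : int := numq y - Num.floor y * denq y.
have dq_gt0 : 0 < (denq y)%:~R :> rat by rewrite ltr0z denq_gt0.
have aE : a%:~R = f * (denq y)%:~R :> rat.
  by rewrite /a rmorphB rmorphM /= numqE -mulrBl.
have a_gt0 : 0 < a by rewrite -(ltr0z rat) aE mulr_gt0.
have a_ltd : a < denq y by rewrite -(ltr_int rat) aE -[ltRHS]mul1r ltr_pM2r.
have fVE : f^-1 = (denq y)%:~R / a%:~R.
  by rewrite aE invfM mulrCA divff ?gt_eqF // mulr1.
have fV_gt1 : 1 < f^-1 by rewrite invf_gt1.
have fl_ge1 : 1 <= Num.floor f^-1 by rewrite floor_ge_int ltW.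
have lt_n : (`|denq f^-1| < n)%N.
  rewrite (leq_trans _ len) // -ltz_nat !absz_denq.
  by rewrite (le_lt_trans _ a_ltd) // fVE denq_frac_le.
have [m /and3P[/= /eqP mE m_ge1 m_last]] := IHn _ lt_n.
exists (Num.floor f^-1 :: m); rewrite /is_rcf /= (negPf dN1) fl_ge1 m_ge1 -mE.
rewrite invrK addrC subrK eqxx /=.
case: (boolP (denq f^-1 == 1)) m_last mE => [d1 /eqP -> /= mE|_].
  by rewrite (_ : 2 = 1 + 1) // lezD1 -(ltr_int rat) -mE.
by case: m {m_ge1} => //= *.
Qed.

Lemma rcf_exists (y : rat) : exists e, is_rcf y e.
Proof. by have [m ym] := rcf_floor_exists y; exists (Num.floor y, m). Qed.

Lemma cfrac_gt1 (a : int) (m : seq int) :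
  all (fun b => 1 <= b) (a :: m) -> 2 <= last a m -> 1 < cfrac a m.
Proof.
elim: m a => [|b m IHm] a /=; first by rewrite ltr1z.
case/and3P=> a1 b1 m1 lm; rewrite -[ltLHS]addr0 ler_ltD ?ler1z //.
by rewrite invr_gt0 (lt_trans ltr01) // IHm //= b1.
Qed.

Lemma cfrac_floor (a : int) (m : seq int) :
  all (fun b => 1 <= b) m -> (m == [::]) || (2 <= last 0 m) ->
  Num.floor (cfrac a m) = a.
Proof.
case: m => [|b m] /= am lm; first by rewrite intrKfloor.
have c1 := cfrac_gt1 am lm; have c0 := lt_trans ltr01 c1.
apply/floor_def; rewrite intrD lerDl invr_ge0 ltW //=.
by rewrite ltrD2l invf_lt1.
Qed.

Lemma cfrac_inj (a b : int) (m n : seq int) :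
  all (fun c => 1 <= c) m -> (m == [::]) || (2 <= last 0 m) ->
  all (fun c => 1 <= c) n -> (n == [::]) || (2 <= last 0 n) ->
  cfrac a m = cfrac b n -> (a, m) = (b, n).
Proof.
elim: m a b n => [|c m IHm] a b [|d n] am lm an ln E.
all: have := E; move: (congr1 Num.floor E); rewrite !cfrac_floor // => -> //=.
- rewrite -[LHS]addr0 => /addrI/esym/eqP; rewrite invr_eq0 gt_eqF //.
  by rewrite (lt_trans ltr01) // cfrac_gt1.
- rewrite -[RHS]addr0 => /addrI/eqP; rewrite invr_eq0 gt_eqF //.
  by rewrite (lt_trans ltr01) // cfrac_gt1.
move=> /addrI/invr_inj {}E.
move: am an => /= /andP[c1 am] /andP[d1 an].
have tail (e : seq int) x : 2 <= last x e -> (e == [::]) || (2 <= last 0 e).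
  by case: e.
by have [-> ->] := IHm c d n am (tail m c lm) an (tail n d ln) E.
Qed.

Lemma rcf_unique (y : rat) e e' : is_rcf y e -> is_rcf y e' -> e = e'.
Proof.
case: e e' => [a m] [b n] /and3P[/= /eqP ya am lm] /and3P[/= /eqP yb bn ln].
apply: cfrac_inj; rewrite -?ya -?yb //.
  by case: ifP lm => _ ->; rewrite ?orbT.
by case: ifP ln => _ ->; rewrite ?orbT.
Qed.

(* The regular continued fraction (m0, [:: m1; ...; ms]) of a rational number. *)
Definition rcf (y : rat) : int * seq int := xchoose (rcf_exists y).

Lemma rcfP (y : rat) : is_rcf y (rcf y).
Proof. exact: xchooseP. Qed.

Section Gauss.
Context {R : realType}.
Implicit Types x : R.

Definition gauss x : R := if x == 0 then 0 else x^-1 - (Num.floor x^-1)%:~R.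

Definition gauss_iter x (j : nat) : R := iter j gauss x.

(* The index is shifted: [gauss_beta x j] is beta_{j-1}(x), with beta_{-1} = 1. *)
Definition gauss_beta x (j : nat) : R := \prod_(i < j) gauss_iter x i.

(* The r-th principal convergent of x in (0,1). Its denominator in lowest terms
   q_r(x) is [denq (convergent x r)]. The value is only meaningful when
   x_0, ..., x_{r-1} are nonzero. *)
Definition convergent x (r : nat) : rat :=
  cfrac 0 [seq Num.floor (gauss_iter x j)^-1 | j <- iota 0 r].

End Gauss.

Definition B_finite (R : realType) (k : nat) (y : rat) : R :=
  let z : R := ratr y - (rcf y).1%:~R in
  \sum_(j < size (rcf y).2) gauss_beta z j ^+ k * ln (gauss_iter z j)^-1.

Definition W_finite (R : realType) (y : rat) : R :=
  let z : R := ratr y - (rcf y).1%:~R in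
  \sum_(j < size (rcf y).2)
    (-1) ^+ j * gauss_beta z j * ln (gauss_iter z j)^-1.

(* Main.v *)
Require Import Defs.
From HB Require Import structures.
From mathcomp Require Import all_boot all_order all_algebra.
From mathcomp Require Import classical_sets reals exp.
From mathcomp Require Import ring lra.

Set Implicit Arguments.
Unset Strict Implicit.
Unset Printing Implicit Defensive.

Import Order.TTheory GRing.Theory Num.Theory.

Local Open Scope ring_scope.

(** Write [x_j] for the Gauss iterates of [x], and [y_j] for the tails of the
convergent [p_r / q_r], so that [x_j = 1 / (m_(j+1) + x_(j+1))] and
[y_j = 1 / (m_(j+1) + y_(j+1))] with the same partial quotients, and [y_r = 0].

The finite sum at the convergent is the sum over [j < r] formed with the [y_j]
in place of the [x_j]. This holds also when the last partial quotient is 1: the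
regular continued fraction then has only [r - 1] steps, but the additional term
is [ln 1 = 0]. Hence both sums obey the same recursion,
[S(x) = ln x^-1 + s * x ^+ k * S(gauss x)] with [s = 1] or [s = -1]
([log_sumS], [log_sum_rat_inv]), and can be compared by induction on [r].

Let [X_j] and [Y_j] be the products of the [x_i] and of the [y_i] over
[j <= i < r]; then [Y_0 = 1 / q_r], [X_0 <= Y_0] ([gauss_beta_le]), and
[|x_j - y_j| = x_r * X_j * Y_j] ([convergent_error]). Unfolding the recursion,
step [j] contributes to the difference of the sums
- the error of the logarithm, weighted by [x_0 ... x_(j-1)], which is at most
  [2 * x_r * X_0 * Y_(j+1)];
- the error of the weight [y_j ^+ k], times the remaining sum, which is at most
  [k * x_r * X_0 * Y_j * F_(j+1)], with [F_(j+1)] the remaining Brjuno sum for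
  [k = 1].
It remains to bound the sums of [Y_(j+1)] and of [Y_j * F_(j+1)] by absolute
constants. The [1 / Y_j], read from [j = r] downwards, grow at least like
Fibonacci numbers, and the inequality [y * ln y^-1 <= 1] absorbs the logarithms;
both facts are encoded in a potential which decreases with every partial
quotient put in front, by at least the error of that step divided by [x_r * X_0]
([potential_step]). Its value at the empty fraction is the constant
[8 + 12 * k]. *)

(** * Regular continued fractions of rational numbers *)

Lemma denq_addz (n : int) (v : rat) : denq (n%:~R + v) = denq v.
Proof.
have d0 : (denq v)%:~R != 0 :> rat by rewrite intr_eq0 denq_neq0.
have -> : n%:~R + v = (n * denq v + numq v)%:~R / (denq v)%:~R.
  by rewrite rmorphD rmorphM /= mulrDl mulfK // divq_num_den.
rewrite coprimeq_den ?denq_eq0 ?normr_denq //.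
rewrite -coprimezE /coprimez gcdzC gcdzMDl gcdzC -/(coprimez _ _).
by rewrite coprimezE coprime_num_den.
Qed.

Lemma denqV (v : rat) : 0 < v -> denq v^-1 = numq v.
Proof.
move=> v0; rewrite -[in LHS](divq_num_den v) invf_div coprimeq_den.
  by rewrite numq_eq0 gt_eqF // gtr0_norm // numq_gt0.
by rewrite coprime_sym coprime_num_den.
Qed.

Lemma cfrac_addz (n a : int) (m : seq int) :
  cfrac (n + a) m = n%:~R + cfrac a m.
Proof. by case: m => [|b m] /=; rewrite rmorphD ?addrA. Qed.

Lemma rcf_eq (y : rat) e : is_rcf y e -> rcf y = e.
Proof. exact: rcf_unique (rcfP y). Qed.

Lemma rcf_floor (y : rat) : (rcf y).1 = Num.floor y.
Proof. by have [m /rcf_eq ->] := rcf_floor_exists y. Qed.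

Lemma rcf_addz (n : int) (y : rat) :
  rcf (n%:~R + y) = (n + (rcf y).1, (rcf y).2).
Proof.
apply: rcf_eq; have /and3P[/eqP yE m1 ml] := rcfP y.
by apply/and3P; split=> //=; rewrite ?denq_addz // cfrac_addz -yE.
Qed.

Lemma rcf_inv (v : rat) : 1 < v -> rcf v^-1 = (0, (rcf v).1 :: (rcf v).2).
Proof.
move=> v1; have v0 := lt_trans ltr01 v1; apply: rcf_eq.
have /and3P[/eqP vE m1 ml] := rcfP v.
have fl1 : 1 <= Num.floor v by rewrite floor_ge_int ltW.
apply/and3P; split=> /=; first by rewrite -vE add0r.
  by rewrite m1 rcf_floor fl1.
case: ifP => [|_].
  rewrite -Qint_def intrEge0 ?invr_ge0 ?ltW // => /natrP[[|n] E].
    by move: v0; rewrite -invr_gt0 E ltxx.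
  have : v^-1 < 1 by rewrite invf_lt1.
  by rewrite E ltrn1.
move: ml vE; case: ((rcf v).2) => [|b l] /=.
  by move=> _ vE; rewrite (_ : 2 = 1 + 1) // lezD1 -(ltr1z rat) -vE.
by case: ifP.
Qed.

(** * Recursions for the logarithmic sums *)

Section LogSums.
Context {R : realType}.
Implicit Types (s x : R) (k n : nat).

Lemma floor_ratr (v : rat) : Num.floor (ratr v : R) = Num.floor v.
Proof.
apply/floor_def; rewrite -!(ratr_int R) ler_rat ltr_rat floor_le.
exact: floorD1_gt.
Qed.

Lemma gauss_iterS x n : gauss_iter x n.+1 = gauss_iter (gauss x) n.
Proof. exact: iterSr. Qed.

Lemma gauss_betaS x n : gauss_beta x n.+1 = x * gauss_beta (gauss x) n.
Proof.
rewrite /gauss_beta big_ord_recl; congr (_ * _).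
by apply: eq_bigr => i _; rewrite lift0 gauss_iterS.
Qed.

Lemma gauss_betaE0 x : gauss_beta x 0 = 1.
Proof. exact: big_ord0. Qed.

(** The weight [s] treats both sums at once: [s = 1] gives the Brjuno sums and
[s = -1] with [k = 1] the Wilton sums. *)
Definition log_sum s k x n : R :=
  \sum_(j < n) s ^+ j * gauss_beta x j ^+ k * ln (gauss_iter x j)^-1.

Definition log_sum_rat s k (v : rat) : R :=
  log_sum s k (ratr v - (rcf v).1%:~R) (size (rcf v).2).

Lemma log_sumS s k x n :
  log_sum s k x n.+1 = ln x^-1 + s * x ^+ k * log_sum s k (gauss x) n.
Proof.
rewrite /log_sum big_ord_recl gauss_betaE0 expr1n !mul1r; congr (_ + _).
rewrite mulr_sumr; apply: eq_bigr => i _.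
rewrite lift0 gauss_betaS gauss_iterS exprS exprMn; ring.
Qed.

Lemma log_sum_rat_addz s k (n : int) (v : rat) :
  log_sum_rat s k (n%:~R + v) = log_sum_rat s k v.
Proof.
rewrite /log_sum_rat rcf_addz /= rmorphD /= ratr_int; congr log_sum.
by rewrite rmorphD /=; ring.
Qed.

Lemma log_sum_rat_int s k (n : int) : log_sum_rat s k n%:~R = 0.
Proof.
rewrite /log_sum_rat; have := rcfP n%:~R; rewrite /is_rcf denq_int eqxx.
by case/and3P=> _ _ /eqP->; rewrite /log_sum big_ord0.
Qed.

(** At [v = 1] the length of the regular continued fraction does not grow, but
the formula survives because the missing term is [ln 1]. This is why a
convergent whose last partial quotient is 1, and whose regular continued
fraction is therefore one step shorter, behaves as all others. *)
Lemma log_sum_rat_inv s k (v : rat) : 1 <= v ->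
  log_sum_rat s k v^-1 =
    ln (ratr v) + s * (ratr v)^-1 ^+ k * log_sum_rat s k v.
Proof.
rewrite le_eqVlt => /predU1P[<-|v1].
  by rewrite invr1 (log_sum_rat_int _ _ 1) rmorph1 ln1 mulr0 addr0.
have v0 : 0 < v := lt_trans ltr01 v1.
rewrite {1}/log_sum_rat rcf_inv //= subr0 log_sumS fmorphV invrK.
congr (_ + _ * log_sum _ _ _ _).
rewrite /gauss invr_eq0 fmorph_eq0 gt_eqF // invrK floor_ratr.
by rewrite rcf_floor.
Qed.

Lemma convergent0 x : convergent x 0 = 0. Proof. by []. Qed.

Lemma convergentS x n : convergent x n.+1 =
  ((Num.floor x^-1)%:~R + convergent (gauss x) n)^-1.
Proof.
rewrite {1}/convergent /= add0r -[Num.floor _ in LHS]addr0 cfrac_addz.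
congr (_ + _)^-1; rewrite /convergent; congr cfrac.
rewrite (iotaDl 1 0) -map_comp; apply: eq_map => j.
by rewrite /= -gauss_iterS.
Qed.

Lemma gauss_ge0 x : 0 <= gauss x.
Proof. by rewrite /gauss; case: eqP => // _; rewrite subr_ge0 floor_le. Qed.

Lemma gauss_lt1 x : gauss x < 1.
Proof.
rewrite /gauss; case: eqP => // _.
by rewrite ltrBlDr addrC -[X in _ + X]/(1%:~R) -intrD floorD1_gt.
Qed.

Lemma floorV_ge1 x : 0 < x -> x < 1 -> 1 <= Num.floor x^-1.
Proof. by move=> x0 x1; rewrite floor_ge_int ltW // invf_gt1. Qed.

Lemma invr_gauss x : x != 0 -> x^-1 = (Num.floor x^-1)%:~R + gauss x.
Proof. by move=> x0; rewrite /gauss (negPf x0) addrC subrK. Qed.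

Lemma gauss_iter_rational x j : gauss_iter x j = 0 -> rational x.
Proof.
elim: j x => [|j IHj] x; first by move=> /= ->; exists 0; rewrite ?rmorph0.
rewrite gauss_iterS; have [-> _|x0 /IHj[q _ qE]] := eqVneq x 0.
  by exists 0; rewrite ?rmorph0.
exists ((Num.floor x^-1)%:~R + q)^-1 => //.
by rewrite fmorphV rmorphD /= ratr_int qE -invr_gauss ?invrK.
Qed.


Lemma gauss_iter_ge0 x j : 0 <= x -> 0 <= gauss_iter x j.
Proof. by case: j => // j _; rewrite /gauss_iter iterS gauss_ge0. Qed.

Lemma gauss_iter_le1 x j : x <= 1 -> gauss_iter x j <= 1.
Proof. by case: j => // j _; rewrite /gauss_iter iterS ltW // gauss_lt1. Qed.

Lemma gauss_beta_ge0 x n : 0 <= x -> 0 <= gauss_beta x n.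
Proof. by move=> x0; apply: prodr_ge0 => i _; exact: gauss_iter_ge0. Qed.

Lemma gauss_beta_le1 x n : 0 <= x <= 1 -> gauss_beta x n <= 1.
Proof.
move=> /andP[x0 x1]; apply: prodr_ile1 => i _.
by rewrite gauss_iter_ge0 ?gauss_iter_le1.
Qed.

Lemma ln_inv_ge0 x : 0 <= x <= 1 -> 0 <= ln x^-1.
Proof.
move=> /andP[]; rewrite le_eqVlt => /predU1P[<- _|x0 x1].
  by rewrite invr0 ln0.
by rewrite ln_ge0 // invf_ge1.
Qed.

Lemma log_sum_le s k x n : `|s| <= 1 -> (1 <= k)%N -> 0 <= x <= 1 ->
  `|log_sum s k x n| <= log_sum 1 1 x n.
Proof.
move=> s1 k1 x01; have /andP[x0 x1] := x01.
apply: le_trans (ler_norm_sum _ _ _) _; apply: ler_sum => j _.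
have b0 := gauss_beta_ge0 j x0; have b1 := gauss_beta_le1 j x01.
have L0 : 0 <= ln (gauss_iter x j)^-1.
  by rewrite ln_inv_ge0 // gauss_iter_ge0 ?gauss_iter_le1.
rewrite expr1n mul1r expr1 !normrM (ger0_norm L0) ler_wpM2r //.
rewrite normrX [X in _ * X]ger0_norm ?exprn_ge0 // -[leRHS]mul1r.
rewrite ler_pM ?exprn_ge0 ?exprn_ile1 //.
by rewrite ler_iXnr.
Qed.

(** Bounding every signed or powered sum by the Brjuno sum with [k = 1] lets a
single potential serve all cases. *)
Lemma log_sum_rat_le s k (v : rat) : `|s| <= 1 -> (1 <= k)%N ->
  `|log_sum_rat s k v| <= log_sum_rat 1 1 v.
Proof.
move=> s1 k1; apply: log_sum_le => //; rewrite rcf_floor -floor_ratr.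
rewrite subr_ge0 floor_le ltW // ltrBlDr addrC.
by rewrite -[X in _ + X]/(1%:~R) -intrD floorD1_gt.
Qed.

Lemma log_sum_rat_ge0 (v : rat) : 0 <= log_sum_rat 1 1 v.
Proof.
have /log_sum_rat_le H : `|1 : R| <= 1 by rewrite normr1.
exact: le_trans (normr_ge0 _) (H 1%N v isT).
Qed.

(** * Convergents *)

Lemma convergent_bounds x r : 0 <= x < 1 ->
  (forall j, (j < r)%N -> gauss_iter x j <> 0) -> 0 <= convergent x r <= 1.
Proof.
elim: r x => [|r IHr] x /andP[x0 x1] nz //.
have xgt0 : 0 < x by rewrite lt0r x0 andbT; apply/eqP/(nz 0).
have m1 := floorV_ge1 xgt0 x1.
have /andP[v0 v1] : 0 <= convergent (gauss x) r <= 1.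
  apply: IHr => [|j jr]; rewrite ?gauss_ge0 ?gauss_lt1 //.
  by rewrite -gauss_iterS; apply: nz.
have d1 : 1 <= (Num.floor x^-1)%:~R + convergent (gauss x) r :> rat.
  by rewrite -[leLHS]addr0 lerD // ler1z.
rewrite convergentS invr_ge0 (le_trans ler01) // invf_le1 //.
exact: lt_le_trans ltr01 d1.
Qed.

Lemma ratr_convergent_bounds x r : 0 <= x < 1 ->
    (forall j, (j < r)%N -> gauss_iter x j <> 0) ->
  0 <= (ratr (convergent x r) : R) <= 1.
Proof.
move=> x01 nz; have /andP[v0] := convergent_bounds x01 nz.
by rewrite ler0q v0 -(ler_rat R) rmorph1.
Qed.

(** All later inductions on [r] peel off the first partial quotient [m] and pass
from [x] to [gauss x]; this collects what happens to the value, the denominator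
and the logarithmic sum of the convergent. *)
Lemma convergent_step x r : 0 <= x < 1 ->
    (forall j, (j < r.+1)%N -> gauss_iter x j <> 0) ->
  exists m : R, let v := convergent (gauss x) r in let w := convergent x r.+1 in
  [/\ 1 <= m, x * (m + gauss x) = 1, ratr w * (m + ratr v) = 1,
      (denq w)%:~R^-1 = ratr w * (denq v)%:~R^-1 :> R &
      forall s k, log_sum_rat s k w =
        ln (m + ratr v) + s * ratr w ^+ k * log_sum_rat s k v].
Proof.
move=> /andP[x0 x1] nz.
have xgt0 : 0 < x by rewrite lt0r x0 andbT; apply/eqP/(nz 0).
have m1 := floorV_ge1 xgt0 x1.
have /andP[v0 v1] : 0 <= convergent (gauss x) r <= 1.
  by apply: convergent_bounds => [|j jr];
    rewrite ?gauss_ge0 ?gauss_lt1 // -gauss_iterS; apply: nz.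
exists (Num.floor x^-1)%:~R => v w.
pose u : rat := (Num.floor x^-1)%:~R + v.
have wE : w = u^-1 by exact: convergentS.
have u1 : 1 <= u by rewrite -[leLHS]addr0 lerD // ler1z.
have u0 : 0 < u := lt_le_trans ltr01 u1.
have uE : (Num.floor x^-1)%:~R + ratr v = ratr u :> R.
  by rewrite rmorphD /= ratr_int.
split.
- by rewrite ler1z.
- by rewrite -invr_gauss ?divff // gt_eqF.
- by rewrite uE wE fmorphV mulVf // fmorph_eq0 gt_eqF.
- rewrite wE denqV // -[numq u]/(numq u) fmorphV -invfM; congr _^-1.
  have /(congr1 (ratr : rat -> R)) := numqE u.
  by rewrite rmorphM /= !ratr_int /u denq_addz.
- by move=> s k; rewrite uE wE log_sum_rat_inv // log_sum_rat_addz fmorphV.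
Qed.

(** If [y = 1 / (m + t)] and [x = 1 / (m + x')], then
[x - y = x * y * (t - x')]. Iterating this down to the empty fraction, where the
error is [x_r], collects the product of all [x_j] and all tails of the
convergent; the latter product is the inverse of the denominator. *)
Lemma convergent_error x r : 0 <= x < 1 ->
    (forall j, (j < r)%N -> gauss_iter x j <> 0) ->
  `|x - ratr (convergent x r)| =
    gauss_iter x r * gauss_beta x r * (denq (convergent x r))%:~R^-1.
Proof.
elim: r x => [|r IHr] x x01 nz.
  by rewrite convergent0 rmorph0 subr0 gauss_betaE0 invr1 !mulr1 ger0_norm //;
    case/andP: x01.
have [m [m1 xm ym dE _]] := convergent_step x01 nz.
have {IHr} := IHr (gauss x); rewrite gauss_ge0 gauss_lt1 => /(_ isT).
have nz' j : (j < r)%N -> gauss_iter (gauss x) j <> 0.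
  by move=> jr; rewrite -gauss_iterS; apply: nz.
move=> /(_ nz'); move: xm ym dE; have := convergent_bounds x01 nz.
move: (convergent (gauss x) r) (convergent x r.+1) => v w.
move=> /andP[w0 _] xm ym dE E.
have -> : x - ratr w = x * ratr w * (ratr v - gauss x).
  transitivity (x * (ratr w * (m + ratr v)) - ratr w * (x * (m + gauss x))).
    by rewrite xm ym !mulr1.
  by ring.
rewrite normrM distrC E dE gauss_iterS gauss_betaS ger0_norm; first by ring.
by rewrite mulr_ge0 ?ler0q //; case/andP: x01.
Qed.

(** With [x = (p + p' * x_r) / (q + q' * x_r)], where [p / q] and [p' / q'] are
the last two convergents, the product of the [x_j] is [(q + q' * x_r)^-1], and
the two inequalities say that [q <= q + q' * x_r] and [p <= p + p' * x_r]. The first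
does not reproduce itself under induction, since numerator and denominator
exchange their roles when a partial quotient is added. *)
Lemma gauss_beta_le x r : 0 <= x < 1 ->
    (forall j, (j < r)%N -> gauss_iter x j <> 0) ->
  gauss_beta x r <= (denq (convergent x r))%:~R^-1 /\
  ratr (convergent x r) * gauss_beta x r <= x * (denq (convergent x r))%:~R^-1.
Proof.
elim: r x => [|r IHr] x x01 nz.
  rewrite convergent0 rmorph0 gauss_betaE0 invr1 !mulr1.
  by split=> //; case/andP: x01.
have [m [m1 xm ym dE _]] := convergent_step x01 nz.
have {IHr} := IHr (gauss x); rewrite gauss_ge0 gauss_lt1 => /(_ isT).
have nz' j : (j < r)%N -> gauss_iter (gauss x) j <> 0.
  by move=> jr; rewrite -gauss_iterS; apply: nz.
move=> /(_ nz'); have := convergent_bounds x01 nz.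
rewrite dE gauss_betaS; move: ym {dE}.
move: (convergent x r.+1) => w; move: (convergent _ r) => v.
move: (_^-1) (gauss_beta _ _) => Y X ym /andP[w0 _] [XY vX].
have w0' : 0 <= ratr w :> R by rewrite ler0q.
have x0 : 0 <= x by case/andP: x01.
split.
- have -> : x * X = (x * ratr w) * (X * (m + ratr v)).
    by rewrite mulrACA ym mulr1.
  have -> : ratr w * Y = (x * ratr w) * (Y * (m + gauss x)).
    by rewrite -[LHS]mul1r -xm; ring.
  by apply: ler_wpM2l; [exact: mulr_ge0 | nra].
- by rewrite mulrCA !ler_wpM2l.
Qed.

(** * Estimates *)

Lemma ln_lipschitz (m a b : R) : 0 < m -> m <= a -> m <= b ->
  `|ln a - ln b| <= `|a - b| / m.
Proof.
move=> m0; wlog ba : a b / b <= a.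
  move=> H ma mb; have [/H->//|/ltW/H le_ab] := leP b a.
  by rewrite distrC [`|a - b|]distrC le_ab.
move=> ma mb; have b0 := lt_le_trans m0 mb; have a0 := lt_le_trans m0 ma.
rewrite !ger0_norm ?subr_ge0 ?ler_ln ?posrE // -ln_div ?posrE //.
have -> : a / b = 1 + (a - b) / b.
  by rewrite mulrBl divff ?gt_eqF // addrC subrK.
apply: le_trans (_ : (a - b) / b <= _).
  apply: le_ln1Dx; rewrite (lt_le_trans (ltrN10 _)) //.
  by rewrite divr_ge0 ?subr_ge0 // ltW.
by rewrite ler_wpM2l ?subr_ge0 // lef_pV2.
Qed.

Lemma dist_expr_le (x y : R) k : 0 <= x <= 1 -> 0 <= y <= 1 ->
  `|x ^+ k - y ^+ k| <= k%:R * `|x - y|.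
Proof.
move=> /andP[x0 x1] /andP[y0 y1]; rewrite subrXX normrM mulrC ler_wpM2r //.
apply: le_trans (ler_norm_sum _ _ _) _.
rewrite -[k in leRHS]card_ord -sumr_const; apply: ler_sum => i _.
by rewrite ger0_norm ?mulr_ge0 ?exprn_ge0 // mulr_ile1 ?exprn_ge0 ?exprn_ile1.
Qed.

(** The error sums carry weights [Y_j], the inverse denominators of the tails of
the convergent, or [Y_j * F_(j+1)], with [F] the logarithmic sum of the tail.
Both series are bounded uniformly in the convergent because two consecutive
steps contract [Y] by at least 1/2; but one step alone may hardly contract
([y] close to 1). The factors [4 - y] and [3 - y] correct for this: when [y] is
close to 1, the next tail [t] is close to 0 and [4 - t] exceeds [4 - y]. *)
Definition potential (k y Y F : R) : R :=
  2 * (4 - y) * Y + k * (3 * (4 - y) * Y + (3 - y) * Y * F).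

Lemma potential_ge0 (k y Y F : R) : 0 <= k -> y <= 1 -> 0 <= Y -> 0 <= F ->
  0 <= potential k y Y F.
Proof.
move=> k0 y1 Y0 F0; rewrite /potential.
have y4 : 0 <= 4 - y by lra.
have y3 : 0 <= 3 - y by lra.
by rewrite addr_ge0 ?mulr_ge0 // addr_ge0 ?mulr_ge0.
Qed.

(** One step of the continued fraction releases enough potential to pay for the
error that the step contributes; [potential k 0 1 0 = 8 + 12 * k] is the budget
at the empty fraction. *)
Lemma potential_step (k m t y Y F : R) : 0 <= k -> 0 <= t <= 1 -> 1 <= m ->
    y * (m + t) = 1 -> 0 <= Y -> 0 <= F ->
  2 * Y + k * (y * Y * F) + potential k y (y * Y) (ln (m + t) + y * F)
    <= potential k t Y F.
Proof.
move=> k0 /andP[t0 t1] m1 ym Y0 F0; have mt0 : 0 < m + t by lra.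
have y0 : 0 < y by rewrite -(pmulr_lgt0 _ mt0) ym.
have yt : y * (1 + t) <= 1 by nra.
have y1 : y <= 1 by nra.
have yL : y * ln (m + t) <= 1.
  by rewrite -ym ler_wpM2l ?ltW // ln_sublinear.
(* Near [y = 1], only [y * (1 + t) <= 1] gives the bound: both sides agree at
   [y = 1], [t = 0]. *)
have a : 0 <= 4 - t - 1 - (4 - y) * y.
  have [yh|yh] := leP y (1/2); first by nra.
  rewrite -(pmulr_rge0 _ y0).
  have -> : y * (4 - t - 1 - (4 - y) * y) =
    (1 - y * (1 + t)) + (1 - y) * (3 * y - 1 - y ^+ 2) by ring.
  rewrite addr_ge0 ?subr_ge0 // mulr_ge0 //; nra.
have b : 0 <= 3 - t - y - (3 - y) * y ^+ 2.
  have [yh|yh] := leP y (1/2); first by nra.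
  rewrite -(pmulr_rge0 _ y0).
  have -> : y * (3 - t - y - (3 - y) * y ^+ 2) =
    (1 - y * (1 + t)) + (4 * y - 1 - y ^+ 2 - 3 * y ^+ 3 + y ^+ 4) by ring.
  have -> : 4 * y - 1 - y ^+ 2 - 3 * y ^+ 3 + y ^+ 4 =
    (1 - y) * ((3 * y - 1) + y ^+ 2 * (2 - y)) by ring.
  rewrite addr_ge0 ?subr_ge0 // mulr_ge0 ?subr_ge0 // addr_ge0 //; first by lra.
  by rewrite mulr_ge0 ?sqr_ge0 //; lra.
have c : 0 <= 3 - (3 - y) * (y * ln (m + t)) by nra.
rewrite -subr_ge0 /potential.
have -> : 2 * (4 - t) * Y + k * (3 * (4 - t) * Y + (3 - t) * Y * F) -
    (2 * Y + k * (y * Y * F) + (2 * (4 - y) * (y * Y) +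
    k * (3 * (4 - y) * (y * Y) + (3 - y) * (y * Y) * (ln (m + t) + y * F)))) =
  2 * Y * (4 - t - 1 - (4 - y) * y) + k * (3 * Y * (4 - t - 1 - (4 - y) * y)
   + Y * F * (3 - t - y - (3 - y) * y ^+ 2)
   + Y * (3 - (3 - y) * (y * ln (m + t)))) by ring.
by repeat first [done | apply: mulr_ge0 | apply: addr_ge0].
Qed.

(** With [T] and [S] the sums of the tails, the error is that of the first
logarithm, plus [s * (y ^+ k - x ^+ k) * T], plus [s * x ^+ k] times the error of
the tails. Each of the three is at most [x_r] times the product of the [x_j]
times a term of [potential_step]. *)
Lemma log_sum_convergent s k x r : `|s| <= 1 -> (1 <= k)%N -> 0 <= x < 1 ->
    (forall j, (j < r)%N -> gauss_iter x j <> 0) ->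
  `|log_sum_rat s k (convergent x r) - log_sum s k x r| <=
    gauss_iter x r * gauss_beta x r *
    (8 + 12 * k%:R - potential k%:R (ratr (convergent x r))
       (denq (convergent x r))%:~R^-1 (log_sum_rat 1 1 (convergent x r))).
Proof.
move=> s1 k1; elim: r x => [|r IHr] x x01 nz.
  rewrite convergent0 (log_sum_rat_int _ _ 0) (log_sum_rat_int _ _ 0).
  rewrite /log_sum big_ord0 subrr normr0 rmorph0 /potential invr1.
  suff -> : 8 + 12 * k%:R - (2 * (4 - 0) * 1 + k%:R * (3 * (4 - 0) * 1 +
    (3 - 0) * 1 * 0)) = 0 :> R by rewrite mulr0.
  by ring.
have [m [m1 xm ym dE wE]] := convergent_step x01 nz.
have x'01 : 0 <= gauss x < 1 by rewrite gauss_ge0 gauss_lt1.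
have nz' j : (j < r)%N -> gauss_iter (gauss x) j <> 0.
  by move=> jr; rewrite -gauss_iterS; apply: nz.
have {IHr} := IHr _ x'01 nz'.
have xN0 : x != 0 by apply/eqP/(nz 0).
have := convergent_error x'01 nz'; have := convergent_error x01 nz.
have := ratr_convergent_bounds x01 nz.
have := ratr_convergent_bounds x'01 nz'.
have Fle v := log_sum_rat_le v s1 k1; have F0 := log_sum_rat_ge0.
rewrite log_sumS !wE dE gauss_iterS gauss_betaS; move: ym {wE dE}.
have : 0 <= (denq (convergent (gauss x) r))%:~R^-1 :> R.
  by rewrite invr_ge0 ler0z denq_ge0.
have := gauss_iter_ge0 r (gauss_ge0 x); have := gauss_beta_ge0 r (gauss_ge0 x).
move: (gauss_iter _ r) (gauss_beta _ r) (log_sum s k _ r) => xr X S.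
move: (convergent x r.+1) => w; move: (convergent _ r) => v.
move: (denq v)%:~R^-1 => Y X0 xr0 Y0 ym v01 w01 Ex Ex' IH.
have Fv := F0 v; move: (Fle v) Fv IH Ex Ex' ym v01 w01 => {Fle F0}.
rewrite mul1r expr1.
move: (log_sum_rat 1 1 v) (log_sum_rat s k v) => F T.
move: (ratr v) (ratr w) => t y TF F0 IH Ex Ex' ym t01 y01.
have k0 : 0 <= k%:R :> R by [].
have := potential_step k0 t01 m1 ym Y0 F0.
have -> : x^-1 = m + gauss x.
  by apply: (mulfI xN0); rewrite divff.
move: (potential _ _ _ _) IH => P' IH; move: (potential _ _ _ _) => P PP.
have [[x0 x1] [x'0 x'1]] := (andP x01, andP x'01).
have /andP[y0 y1] := y01; have /andP[t0 t1] := t01.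
have m0 : 0 < m := lt_le_trans ltr01 m1.
(* The slope [1 / m] of [ln] is at most [2 * x], as [m + gauss x <= 2 * m]. *)
have Lle : `|ln (m + t) - ln (m + gauss x)| <= 2 * x * (xr * X * Y).
  apply: le_trans (ln_lipschitz m0 _ _) _; rewrite ?lerDl //.
  rewrite opprD addrACA subrr add0r distrC Ex' mulrC ler_wpM2r ?mulr_ge0 //.
  rewrite -[leLHS]mul1r ler_pdivrMr //; nra.
have Ple : `|y ^+ k - x ^+ k| * `|T| <= k%:R * (xr * (x * X) * (y * Y)) * F.
  rewrite ler_pM //; apply: le_trans (dist_expr_le k y01 _) _.
    by rewrite x0 ltW.
  by rewrite distrC Ex.
have Dle : `|x ^+ k * (T - S)| <= x * (xr * X * (8 + 12 * k%:R - P')).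
  rewrite normrM ler_pM // normrX ger0_norm // ler_iXnr //.
  by rewrite ltW.
have -> : ln (m + t) + s * y ^+ k * T - (ln (m + gauss x) + s * x ^+ k * S)
  = (ln (m + t) - ln (m + gauss x)) +
    s * ((y ^+ k - x ^+ k) * T + x ^+ k * (T - S)) by ring.
apply: le_trans (ler_normD _ _) _.
have sle : `|s * ((y ^+ k - x ^+ k) * T + x ^+ k * (T - S))| <=
    k%:R * (xr * (x * X) * (y * Y)) * F + x * (xr * X * (8 + 12 * k%:R - P')).
  rewrite normrM; apply: le_trans (ler_piMl (normr_ge0 _) s1) _.
  by apply: le_trans (ler_normD _ _) _; rewrite lerD // normrM.
apply: le_trans (lerD Lle sle) _.
have -> : 2 * x * (xr * X * Y) + (k%:R * (xr * (x * X) * (y * Y)) * F +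
    x * (xr * X * (8 + 12 * k%:R - P'))) =
  xr * (x * X) * (2 * Y + k%:R * (y * Y * F) + (8 + 12 * k%:R - P')) by ring.
by apply: ler_wpM2l; [rewrite !mulr_ge0 | lra].
Qed.

Lemma log_sum_convergent_le s k x r : `|s| <= 1 -> (1 <= k)%N -> 0 <= x < 1 ->
    (forall j, (j < r)%N -> gauss_iter x j <> 0) ->
  `|log_sum_rat s k (convergent x r) - log_sum s k x r| <=
    (8 + 12 * k%:R) * gauss_iter x r * (denq (convergent x r))%:~R^-1.
Proof.
move=> s1 k1 x01 nz; apply: le_trans (log_sum_convergent s1 k1 x01 nz) _.
have [bY _] := gauss_beta_le x01 nz.
have /andP[x0 _] := x01.
have xr0 := gauss_iter_ge0 r x0; have b0 := gauss_beta_ge0 r x0.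
have /andP[_ v1] := ratr_convergent_bounds x01 nz.
have Y0 : 0 <= (denq (convergent x r))%:~R^-1 :> R.
  by rewrite invr_ge0 ler0z denq_ge0.
have C0 : 0 <= 8 + 12 * k%:R :> R by rewrite addr_ge0 ?mulr_ge0.
rewrite [leRHS](_ : _ = gauss_iter x r * (denq (convergent x r))%:~R^-1 *
  (8 + 12 * k%:R)); last by ring.
apply: le_trans (_ : gauss_iter x r * gauss_beta x r * (8 + 12 * k%:R) <= _).
  by rewrite ler_wpM2l ?mulr_ge0 // gerBl potential_ge0 ?log_sum_rat_ge0.
by rewrite ler_wpM2r // ler_wpM2l.
Qed.

End LogSums.

Theorem lemma3p1 (R : realType) :
  (exists C : nat -> R,
    (forall k : nat, (1 <= k)%N -> 0 < C k) /\
    forall (x : R) (r : nat), 0 < x -> x < 1 ->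
      (forall j : nat, (j < r)%N -> gauss_iter x j <> 0) ->
      (forall k : nat, (1 <= k)%N ->
        `|B_finite R k (convergent x r)
          - \sum_(j < r) gauss_beta x j ^+ k * ln (gauss_iter x j)^-1|
        <= C k * gauss_iter x r * (denq (convergent x r))%:~R^-1) /\
      `|W_finite R (convergent x r)
        - \sum_(j < r) (-1) ^+ j * gauss_beta x j * ln (gauss_iter x j)^-1|
      <= C 1%N * gauss_iter x r * (denq (convergent x r))%:~R^-1) /\
  (forall x : R, 0 < x -> x < 1 -> irrational x ->
    forall j : nat, gauss_iter x j <> 0).
Proof.
split; last by move=> x _ _ irr j /gauss_iter_rational.
exists (fun k => 8 + 12 * k%:R); split=> [k _|x r x0 x1 nz].
  by rewrite ltr_wpDr ?mulr_ge0.
have x01 : 0 <= x < 1 by rewrite ltW.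
have BE k z n : \sum_(j < n) gauss_beta z j ^+ k * ln (gauss_iter z j)^-1
    = log_sum 1 k z n :> R.
  by apply: eq_bigr => j _; rewrite expr1n mul1r.
split=> [k k1|].
  by rewrite /B_finite !BE; apply: log_sum_convergent_le; rewrite ?normr1.
by apply: (@log_sum_convergent_le _ (-1) 1); rewrite ?normrN1.
Qed.
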